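(* Let $\mathbb{V}=U\oplus W$ be a finite-dimensional vector space over a field $\mathcal{F}$, where $U$ and $W$ are nonzero subspaces and $\dim(\mathbb{V})>1$. Then the domination number of the direct sum graph $\Gamma_{U\oplus W}(\mathbb{V})$ is $1$.
   Context: Let $\mathbb{V}$ be a vector space over a field $\mathcal{F}$ with $\mathbb{V}=U\oplus W$, where $U,W$ are nonzero subspaces, $\dim U=r$, $\dim W=s$, $r+s=n=\dim\mathbb{V}$. Fix a basis $\{\alpha_1,\dots,\alpha_r\}$ of $U$ and a basis $\{\beta_1,\dots,\beta_s\}$ of $W$; every $x\in\mathbb{V}$ is written uniquely as $x=a_1\alpha_1+\dots+a_r\alpha_r+b_1\beta_1+\dots+b_s\beta_s$. The direct sum graph $\Gamma_{U\oplus W}(\mathbb{V})$ is the simple graph whose vertex set is $\{x=u+w: u\in U, w\in W, u\neq 0, w\neq 0\}$, in which two distinct vertices $x,y$ are adjacent iff there is an index $i$ such that the coefficient of $\alpha_i$ is nonzero in both $x$ and $y$, and there is an index $j$ such that the coefficient of $\beta_j$ is nonzero in both $x$ and $y$. A set $D$ of vertices is dominating if every vertex not in $D$ is adjacent to some vertex of $D$; the domination number is the minimum size of a dominating set. *)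

(* Defs.v *)
From mathcomp Require Import all_boot all_order all_algebra.
From mathcomp Require Import classical_sets cardinality.

Set Implicit Arguments.
Unset Strict Implicit.
Unset Printing Implicit Defensive.

Import GRing.Theory.
Local Open Scope classical_set_scope.
Local Open Scope card_scope.
Local Open Scope ring_scope.

(* Simple graphs whose vertices form a possibly infinite subset of T: over an
   infinite field the direct sum graph is infinite. *)
Record sgraph (T : Type) := SGraph {
  vertices : set T;
  adjacent : T -> T -> Prop;
  adjacent_vertices : forall x y, adjacent x y -> vertices x /\ vertices y;
  adjacent_sym : forall x y, adjacent x y -> adjacent y x;
  adjacent_irrefl : forall x, ~ adjacent x x }.

Definition dominating (T : Type) (G : sgraph T) (D : set T) : Prop :=
  D `<=` vertices G /\
  forall y, vertices G y -> ~ D y -> exists2 x, D x & adjacent G y x.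

(* `I_k is the set of naturals below k, so A #= `I_k means |A| = k and
   `I_k #<= A means k <= |A|, the latter also covering infinite A. *)
Definition is_domination_number (T : Type) (G : sgraph T) (k : nat) : Prop :=
  (exists2 D : set T, dominating G D & D #= `I_k) /\
  forall D : set T, dominating G D -> `I_k #<= D.

Definition dsg_vertices (F : fieldType) (vT : vectType F)
    (U W : {vspace vT}) : set vT :=
  [set x | exists u w : vT,
     [/\ u \in U, w \in W, u != 0, w != 0 & x = u + w]].

(* Coefficients are taken in the concatenated family alpha ++ beta, a basis of
   the whole space when alpha and beta are bases of complementary subspaces. *)
Definition dsg_adjacent (F : fieldType) (vT : vectType F) (U W : {vspace vT})
    (r s : nat) (alpha : r.-tuple vT) (beta : s.-tuple vT) (x y : vT) : Prop :=
  let e : (r + s).-tuple vT := [tuple of alpha ++ beta] in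
  [/\ dsg_vertices U W x, dsg_vertices U W y, x != y,
      exists i : 'I_r, coord e (lshift s i) x != 0 /\
                       coord e (lshift s i) y != 0
    & exists j : 'I_s, coord e (rshift r j) x != 0 /\
                       coord e (rshift r j) y != 0].

Section DirectSumGraph.
Variables (F : fieldType) (vT : vectType F) (U W : {vspace vT}).
Variables (r s : nat) (alpha : r.-tuple vT) (beta : s.-tuple vT).

Lemma dsg_adjacent_vertices (x y : vT) :
  dsg_adjacent U W alpha beta x y -> dsg_vertices U W x /\ dsg_vertices U W y.
Proof. by case. Qed.

Lemma dsg_adjacent_sym (x y : vT) :
  dsg_adjacent U W alpha beta x y -> dsg_adjacent U W alpha beta y x.
Proof.
case=> Vx Vy xy [i [xi yi]] [j [xj yj]]; split=> //; first by rewrite eq_sym.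
- by exists i.
- by exists j.
Qed.

Lemma dsg_adjacent_irrefl (x : vT) : ~ dsg_adjacent U W alpha beta x x.
Proof. by case=> _ _; rewrite eqxx. Qed.

Definition direct_sum_graph : sgraph vT :=
  SGraph dsg_adjacent_vertices dsg_adjacent_sym dsg_adjacent_irrefl.

End DirectSumGraph.

(* Main.v *)
(** The vector all of whose coordinates equal 1 is a vertex, and it is adjacent
    to every other vertex [u + w]: since [u] and [w] are nonzero, each has a
    nonzero coordinate. *)
Require Import Defs.
From mathcomp Require Import all_boot all_order all_algebra.
From mathcomp Require Import classical_sets cardinality.

Import GRing.Theory.
Local Open Scope ring_scope.

(** One universal vertex gives domination number 1, by [is_domination_number1]. The sum of all
    vectors of both bases is such a vertex: its coordinates are all 1 ([coord_sum_family]), so a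
    common nonzero coordinate with [u + w] on each side only requires one for [u] over [alpha] and
    one for [w] over [beta] ([coord_neq0]). Since adjacency reads coordinates in the concatenated
    basis, [coord_cat] reduces them to the two separate bases. *)

Lemma coord_cat {F : fieldType} {vT : vectType F} {r s : nat}
    {X : r.-tuple vT} {Y : s.-tuple vT} {u w : vT} :
    free (X ++ Y) -> u \in <<X>>%VS -> w \in <<Y>>%VS ->
  (forall i, coord [tuple of X ++ Y] (lshift s i) (u + w) = coord X i u) /\
  (forall j, coord [tuple of X ++ Y] (rshift r j) (u + w) = coord Y j w).
Proof.
move=> freeXY uX wY.
(* Gluing the two coordinate families gives an expansion of [u + w] over [X ++ Y]; freeness makes
   its coefficients the coordinates. *)
pose c (k : 'I_(r + s)) :=
  match split k with inl i => coord X i u | inr j => coord Y j w end.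
have -> : u + w = \sum_(k < r + s) c k *: [tuple of X ++ Y]`_k.
  rewrite {1}(coord_span uX) {1}(coord_span wY) big_split_ord /=.
  congr (_ + _); apply: eq_bigr => i _.
    by rewrite /c (unsplitK (inl _ i)) nth_cat size_tuple ltn_ord.
  rewrite /c (unsplitK (inr _ i)) nth_cat size_tuple.
  by rewrite ltnNge leq_addr /= addKn.
split=> i; rewrite (coord_sum_free _ _ (X := [tuple of X ++ Y]) freeXY) /c.
  by rewrite (unsplitK (inl _ i)).
by rewrite (unsplitK (inr _ i)).
Qed.

Lemma coord_neq0 {F : fieldType} {vT : vectType F} {n : nat}
    {X : n.-tuple vT} {u : vT} :
  u \in <<X>>%VS -> u != 0 -> exists i, coord X i u != 0.
Proof.
move=> uX u0; apply/existsP; apply: contraNT u0 => /existsPn c0.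
rewrite (coord_span uX) big1 // => i _.
by have /negPn/eqP-> := c0 i; rewrite scale0r.
Qed.

Lemma coord_sum_family {F : fieldType} {vT : vectType F} {n : nat}
    {X : n.-tuple vT} (i : 'I_n) :
  free X -> coord X i (\sum_(k < n) X`_k) = 1.
Proof.
move=> freeX; under eq_bigr => k _ do rewrite -[X`_k]scale1r.
exact: (coord_sum_free (fun=> 1)).
Qed.

Lemma sum_basis_neq0 {F : fieldType} {vT : vectType F} {V : {vspace vT}}
    {n : nat} {X : n.-tuple vT} :
  basis_of V X -> V != 0%VS -> \sum_(k < n) X`_k != 0.
Proof.
move=> bX; rewrite -vpick0 => V0.
(* The nonzero vector [vpick V] serves only to produce an index [i], that is, to show that the basis
   is nonempty; at [i] the sum has coordinate 1, which is nonzero. *)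
have VX : vpick V \in <<X>>%VS by rewrite (span_basis bX) memv_pick.
have [i _] := coord_neq0 VX V0.
apply: contraTneq (oner_neq0 F) => s0.
by rewrite -(coord_sum_family i (basis_free bX)) s0 linear0 eqxx.
Qed.

Lemma memv_sum_basis {F : fieldType} {vT : vectType F} {V : {vspace vT}}
    {n : nat} {X : n.-tuple vT} :
  basis_of V X -> \sum_(k < n) X`_k \in V.
Proof.
move=> bX; apply: memv_suml => k _; rewrite (basis_mem bX) //.
by rewrite mem_nth // size_tuple.
Qed.

Lemma is_domination_number1 {T : Type} {G : sgraph T} {x : T} :
    vertices G x ->
    (forall y, vertices G y -> y <> x -> adjacent G y x) ->
  is_domination_number G 1.
Proof.
move=> Vx adjx; split.
  exists [set x]%classic; last exact: card_set1.
  by split=> [y -> //|y Vy yx]; exists x => //; exact: adjx.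
move=> D [_ domD].
(* An empty set fails to dominate [x]; otherwise a singleton inside [D] gives the lower bound,
   whether [D] is finite or not. *)
have [D0|/set0P[y Dy]] := eqVneq D set0.
  by have [|z] := domD x Vx; rewrite D0.
by rewrite -(card_le_eql (@card_set1 _ y)); apply: subset_card_le => _ ->.
Qed.

Theorem theorem2p3 (F : fieldType) (vT : vectType F) (U W : {vspace vT})
    (r s : nat) (alpha : r.-tuple vT) (beta : s.-tuple vT)
    (hUW : (U + W)%VS = fullv) (hdirect : directv (U + W))
    (hU : U != 0%VS) (hW : W != 0%VS) (hdim : (1 < \dim (fullv : {vspace vT}))%N)
    (halpha : basis_of U alpha) (hbeta : basis_of W beta) :
  is_domination_number (direct_sum_graph U W alpha beta) 1.
Proof.
have freeab : free (alpha ++ beta) :=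
  basis_free (cat_basis hdirect halpha hbeta).
pose a := \sum_(k < r) alpha`_k; pose b := \sum_(k < s) beta`_k.
have aU : a \in U := memv_sum_basis halpha.
have bW : b \in W := memv_sum_basis hbeta.
have Vab : dsg_vertices U W (a + b).
  exists a, b; split=> //; first exact: sum_basis_neq0 halpha hU.
  exact: sum_basis_neq0 hbeta hW.
apply: (@is_domination_number1 _ _ (a + b)) => // y Vy /eqP yab.
have [u [w [uU wW u0 w0 yE]]] := Vy.
(* The coordinate lemmas take membership in the spans of the bases. *)
rewrite -(span_basis halpha) in uU aU; rewrite -(span_basis hbeta) in wW bW.
have [ca cb] := coord_cat freeab aU bW.
have [cu cw] := coord_cat freeab uU wW.
have [i ui] := coord_neq0 uU u0.
have [j wj] := coord_neq0 wW w0.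
split=> //; [exists i|exists j].
  by rewrite ca yE cu coord_sum_family ?oner_neq0 ?(basis_free halpha).
by rewrite cb yE cw coord_sum_family ?oner_neq0 ?(basis_free hbeta).
Qed.
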